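(* Let $\lambda>0$ and let $F(\mathbf{x})=\lambda f(\mathbf{g}(\mathbf{x}))+h(\mathbf{x})$, $\mathbf{x}\in\mathbb{R}^n$, where $f,\mathbf{g},h$ satisfy conditions C1–C4 of the context. Let $L(h)>0$ be the Lipschitz constant of $\nabla h$, let $\mu>\frac{L(h)}{2}$, let $\{\mathbf{x}^k\}$ be a sequence generated by the PIRE algorithm (described in the context) with parameter $\mu$, and let $D=F(\mathbf{x}^1)$. Then: (1) $F(\mathbf{x}^k)$ is monotonically decreasing (non-increasing) in $k\ge 1$; indeed, for all $k\ge 1$, $$F(\mathbf{x}^k)-F(\mathbf{x}^{k+1})\geq\left(\mu-\frac{L(h)}{2}\right)\|\mathbf{x}^k-\mathbf{x}^{k+1}\|_2^2.$$ (2) The sequence $\{\mathbf{x}^k\}$ is bounded. (3) $\sum_{k=1}^\infty\|\mathbf{x}^k-\mathbf{x}^{k+1}\|_2^2\leq \frac{2D}{2\mu-L(h)}$. In particular, $\lim_{k\rightarrow\infty}(\mathbf{x}^k-\mathbf{x}^{k+1})=\mathbf{0}$.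
   Context: Conditions. C1: $f:[0,\infty)^d\to\mathbb{R}$ is nonnegative, concave and increasing (meaning non-decreasing in each coordinate). C2: $\mathbf{g}:\mathbb{R}^n\to\mathbb{R}^d$ has nonnegative components, and for every nonnegative $\mathbf{w}\in\mathbb{R}^d$ and every $\mathbf{b}\in\mathbb{R}^n$ the problem $\min_{\mathbf{x}\in\mathbb{R}^n}\lambda\langle\mathbf{w},\mathbf{g}(\mathbf{x})\rangle+\frac12\|\mathbf{x}-\mathbf{b}\|_2^2$ is convex. C3: $h:\mathbb{R}^n\to\mathbb{R}$ is continuously differentiable with $\|\nabla h(\mathbf{x})-\nabla h(\mathbf{y})\|\le L(h)\|\mathbf{x}-\mathbf{y}\|$ for all $\mathbf{x},\mathbf{y}\in\mathbb{R}^n$. C4: $\lambda f(\mathbf{g}(\mathbf{x}))+h(\mathbf{x})\to\infty$ if and only if $\|\mathbf{x}\|_2\to\infty$. PIRE algorithm. Start from an initial point $\mathbf{x}^0\in\mathbb{R}^n$ and a nonnegative weight $\mathbf{w}^0\in\mathbb{R}^d$. For $k=0,1,2,\dots$ set $$\mathbf{x}^{k+1}=\arg\min_{\mathbf{x}\in\mathbb{R}^n}\ \lambda\langle\mathbf{w}^k,\mathbf{g}(\mathbf{x})\rangle+\frac{\mu}{2}\left\|\mathbf{x}-\left(\mathbf{x}^k-\frac1\mu\nabla h(\mathbf{x}^k)\right)\right\|_2^2,$$ and then choose $\mathbf{w}^{k+1}\in-\partial(-f)(\mathbf{g}(\mathbf{x}^{k+1}))$. Here $\partial(-f)(\mathbf{y}_0)$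 is the convex subdifferential of $-f$ at $\mathbf{y}_0$, so $\mathbf{w}\in-\partial(-f)(\mathbf{y}_0)$ means $f(\mathbf{y})\le f(\mathbf{y}_0)+\langle\mathbf{w},\mathbf{y}-\mathbf{y}_0\rangle$ for all $\mathbf{y}\in[0,\infty)^d$. It is assumed that such choices are possible along the generated (infinite) sequence.
   Formalization: The bound 2D/(2μ−L(h)) in (3) is proved only when F ≥ 0 everywhere, since it fails if F can be negative (e.g. f=0, g=0, h(x)=x²/2−100); finiteness of the sum, the limit, and (1)–(2) need no such assumption. *)

(* Defs.v *)
From HB Require Import structures.
From mathcomp Require Import all_boot all_order all_algebra.
From mathcomp Require Import all_classical all_reals all_analysis.

Set Implicit Arguments.
Unset Strict Implicit.
Unset Printing Implicit Defensive.

Import Order.TTheory GRing.Theory Num.Theory.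
Import numFieldNormedType.Exports.

Local Open Scope classical_set_scope.
Local Open Scope ring_scope.

Section Euclidean.
Context {R : realType} {n : nat}.
Implicit Types u v : 'rV[R]_n.

Definition dot u v : R := \sum_(i < n) u 0 i * v 0 i.

(* The library norm on row vectors is the sup norm, hence this separate
   Euclidean norm; both induce the same topology. *)
Definition norm2 u : R := Num.sqrt (dot u u).

Definition orthant : set 'rV[R]_n := [set y | forall i, 0 <= y 0 i].

Definition gradient (h : 'rV[R]_n -> R) (x : 'rV[R]_n) : 'rV[R]_n :=
  \row_(i < n) 'D_(delta_mx 0 i) h x.

Definition subdifferential (A : set 'rV[R]_n) (phi : 'rV[R]_n -> R)
    (y0 : 'rV[R]_n) : set 'rV[R]_n :=
  [set v | forall y, A y -> phi y0 + dot v (y - y0) <= phi y].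

Definition is_argmin (phi : 'rV[R]_n -> R) (x : 'rV[R]_n) :=
  forall y, phi x <= phi y.

End Euclidean.

Section Conditions.
Context {R : realType} {n d : nat}.
Variables (lambda : R) (f : 'rV[R]_d -> R) (g : 'rV[R]_n -> 'rV[R]_d)
  (h : 'rV[R]_n -> R).

Definition objective (x : 'rV[R]_n) : R := lambda * f (g x) + h x.

(* f is a function on the nonnegative orthant only: its values elsewhere are
   never constrained nor used. *)
Definition condC1 :=
  [/\ forall y, orthant y -> 0 <= f y,
      convex_function orthant (fun y => - f y : R^o) &
      forall y (i : 'I_d) (t : R), orthant y -> 0 <= t ->
        f y <= f (y + t *: delta_mx 0 i)].

Definition condC2 :=
  (forall x, orthant (g x)) /\
  forall (w : 'rV[R]_d) (b : 'rV[R]_n), orthant w ->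
    convex_function setT
      (fun x => lambda * dot w (g x) + 2^-1 * norm2 (x - b) ^+ 2 : R^o).

Definition condC3 (L : R) :=
  [/\ forall x, differentiable h x,
      continuous (gradient h) &
      forall x y, norm2 (gradient h x - gradient h y) <= L * norm2 (x - y)].

Definition condC4 :=
  forall u : nat -> 'rV[R]_n,
    (objective (u j) @[j --> \oo] --> +oo) <->
    (norm2 (u j) @[j --> \oo] --> +oo).

Definition PIRE (mu : R) (x : nat -> 'rV[R]_n) (w : nat -> 'rV[R]_d) :=
  [/\ orthant (w 0%N),
      forall k, is_argmin
        (fun z => lambda * dot (w k) (g z) +
           mu / 2 * norm2 (z - (x k - mu^-1 *: gradient h (x k))) ^+ 2)
        (x k.+1) &
      forall k, subdifferential orthant (fun y => - f y) (g (x k.+1))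
        (- w k.+1)].

End Conditions.

(* Main.v *)
(* The update [x k.+1] minimizes a convex function plus [mu / 2 * |x - b|^2], with
   [b = x k - G / mu] and [G] the gradient of [h] at [x k].  Its first-order
   condition along the segment to [x k] yields
   [lambda <w, g(x k.+1)> <= lambda <w, g(x k)> + <G, v> - mu |v|^2], where
   [v = x k - x k.+1].  Adding the supergradient inequality for [f] and the
   descent lemma for [h] cancels [G] and gives the sufficient decrease.
   Coercivity C4 then bounds the iterates, and the descent lemma bounds [h],
   hence [F], from below along them, so the telescoping sum of the decreases is
   finite even when [F] takes negative values. *)
Require Import Defs.
From HB Require Import structures.
From mathcomp Require Import all_boot all_order all_algebra.
From mathcomp Require Import ring lra.
From mathcomp Require Import all_classical all_reals all_analysis.
Import Order.TTheory GRing.Theory Num.Theory.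
Import numFieldNormedType.Exports.
Local Open Scope classical_set_scope.
Local Open Scope ring_scope.

(** * Euclidean geometry, gradients along lines and the descent lemma *)

Section Dot.
Context {R : realType} {n : nat}.
Implicit Types u v w : 'rV[R]_n.

Lemma dotC u v : dot u v = dot v u.
Proof. by apply: eq_bigr => i _; rewrite mulrC. Qed.

Lemma dotDl u v w : dot (u + v) w = dot u w + dot v w.
Proof. by rewrite -big_split/=; apply: eq_bigr => i _; rewrite mxE mulrDl. Qed.

Lemma dotZl (a : R) u v : dot (a *: u) v = a * dot u v.
Proof. by rewrite mulr_sumr; apply: eq_bigr => i _; rewrite mxE mulrA. Qed.

Lemma dotNl u v : dot (- u) v = - dot u v.
Proof. by rewrite -scaleN1r dotZl mulN1r. Qed.

Lemma dotDr u v w : dot w (u + v) = dot w u + dot w v.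
Proof. by rewrite !(dotC w) dotDl. Qed.

Lemma dotZr (a : R) u v : dot v (a *: u) = a * dot v u.
Proof. by rewrite !(dotC v) dotZl. Qed.

Lemma dotNr u v : dot v (- u) = - dot v u.
Proof. by rewrite !(dotC v) dotNl. Qed.

Definition dotE := (dotDl, dotDr, dotNl, dotNr, dotZl, dotZr).

Lemma dot_ge0 u : 0 <= dot u u.
Proof. by apply: sumr_ge0 => i _; rewrite -expr2 sqr_ge0. Qed.

Lemma sqr_norm2 u : norm2 u ^+ 2 = dot u u.
Proof. by rewrite sqr_sqrtr// dot_ge0. Qed.

Lemma sqr_norm2D u v :
  norm2 (u + v) ^+ 2 = norm2 u ^+ 2 + 2 * dot u v + norm2 v ^+ 2.
Proof. by rewrite !sqr_norm2 !dotE (dotC v u); ring. Qed.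

Lemma norm2_ge0 u : 0 <= norm2 u.
Proof. exact: sqrtr_ge0. Qed.

Lemma norm2N u : norm2 (- u) = norm2 u.
Proof. by rewrite /norm2 dotNl dotNr opprK. Qed.

Lemma norm2Z (a : R) u : norm2 (a *: u) = `|a| * norm2 u.
Proof.
by rewrite /norm2 dotZl dotZr mulrA -expr2 sqrtrM ?sqr_ge0// sqrtr_sqr.
Qed.

Lemma norm2_eq0 u : norm2 u = 0 -> u = 0.
Proof.
move=> u0; have /eqP : dot u u = 0 by rewrite -sqr_norm2 u0 expr0n.
rewrite psumr_eq0; last by move=> i _; rewrite -expr2 sqr_ge0.
move=> /allP u00; apply/rowP => i; rewrite mxE; apply/eqP.
by have := u00 i (mem_index_enum _); rewrite mulf_eq0 orbb.
Qed.

Lemma dot0l u : dot 0 u = 0.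
Proof. by rewrite -(scale0r 0) dotZl mul0r. Qed.

(** The squared length of [norm2 v *: u - norm2 u *: v] is the claimed difference times
    [2 * (norm2 u * norm2 v)]; zero vectors are set apart so that this factor can be cancelled. *)
Lemma cauchy_schwarz u v : dot u v <= norm2 u * norm2 v.
Proof.
have [/norm2_eq0 ->|u0] := eqVneq (norm2 u) 0.
  by rewrite dot0l mulr_ge0// norm2_ge0.
have [/norm2_eq0 ->|v0] := eqVneq (norm2 v) 0.
  by rewrite dotC dot0l mulr_ge0// norm2_ge0.
have uv : 0 < norm2 u * norm2 v by rewrite mulr_gt0// lt_def norm2_ge0 ?u0 ?v0.
have := dot_ge0 (norm2 v *: u - norm2 u *: v).
rewrite !dotE -!sqr_norm2 (dotC v u) => H.
rewrite -(ler_pM2l uv) -subr_ge0.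
set a := norm2 u in H *; set b := norm2 v in H *.
lra.
Qed.

(** Transfers Euclidean smallness of the steps to the sup norm, in which convergence of row vectors
    is tested. *)
Lemma ler_mx_norm_norm2 u : `|u| <= norm2 u.
Proof.
rewrite [leLHS]/Num.norm/= mx_normrE; apply/bigmax_leP.
split; first exact: norm2_ge0.
move=> [i j] _ /=; rewrite ord1 -sqrtr_sqr ler_wsqrtr//.
rewrite /dot (bigD1 j)//= -expr2 lerDl; apply: sumr_ge0 => k _.
by rewrite -expr2 sqr_ge0.
Qed.

Lemma dot_gradient (h : 'rV[R]_n -> R) x v :
  differentiable h x -> dot (gradient h x) v = 'd h x v.
Proof.
move=> hx; rewrite {2}(row_sum_delta v) linear_sum /dot.
by apply: eq_bigr => i _; rewrite linearZ/= mxE deriveE// mulrC.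
Qed.

Lemma is_derive_line (h : 'rV[R]_n -> R) x v (t : R) :
  differentiable h (x + t *: v) ->
  is_derive t 1 (fun s : R => h (x + s *: v)) (dot (gradient h (x + t *: v)) v).
Proof.
move=> hd; have dl : is_diff t (fun s : R => x + s *: v) ( *:%R^~ v).
  by apply: is_diff_eq; rewrite add0r.
have dh := differentiableP hd.
have dc := is_diff_comp dl dh.
have df : differentiable (fun s : R => h (x + s *: v)) t.
  exact: (@ex_diff _ _ _ _ _ _ _ dc).
apply: DeriveDef; first exact/derivable1_diffP.
rewrite deriveE// dot_gradient//.
by have /(congr1 (@^~ 1)) := @diff_val _ _ _ _ _ _ _ dc; rewrite /= scale1r.
Qed.

Lemma descent_lemma (h : 'rV[R]_n -> R) (L : R) x y : condC3 h L ->
  h y <= h x + dot (gradient h x) (y - x) + L / 2 * norm2 (y - x) ^+ 2.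
Proof.
move=> [hd _ hL]; set v := y - x.
pose p (t : R) := h (x + t *: v) -
  (t * dot (gradient h x) v + L / 2 * norm2 v ^+ 2 * t ^+ 2).
have dp (t : R) : is_derive t 1 p
    (dot (gradient h (x + t *: v)) v -
      (dot (gradient h x) v + L * norm2 v ^+ 2 * t)).
  have dh := is_derive_line _ _ _ _ (hd (x + t *: v)).
  rewrite /p; apply: is_derive_eq.
  by rewrite /GRing.scale/=; field.
have : p 1 <= p 0.
  apply: (@ler0_derive1_nincr _ p 0 1) => //.
  - move=> t; rewrite in_itv/= => /andP[t0 _].
    rewrite derive1E derive_val.
    have := cauchy_schwarz (gradient h (x + t *: v) - gradient h x) v.
    have := hL (x + t *: v) x; rewrite addrAC subrr add0r norm2Z gtr0_norm//.
    move=> /(ler_wpM2r (norm2_ge0 v)); rewrite dotDl dotNl; lra.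
  - apply: derivable_within_continuous => t _; exact: ex_derive.
rewrite /p !scale1r scale0r addr0 mul1r mul0r expr1n expr0n/=.
rewrite mulr0 addr0 subr0 mulr1 [x + v]addrC subrK; lra.
Qed.
End Dot.

(** * Convexity of the weighted term and one proximal step *)

Lemma ge0_of_affine_perturbation {R : realType} (a b : R) :
  0 <= b -> (forall t, 0 < t -> t <= 1 -> 0 <= a + t * b) -> 0 <= a.
Proof.
move=> b0 H; rewrite leNgt; apply/negP => a0.
have ba : 0 < b - a by lra.
(* The denominator [b - a], unlike [b], cannot vanish and keeps this [t] at most 1; the affine
   function is still negative there. *)
have t0 : 0 < - a / (b - a) by rewrite divr_gt0// oppr_gt0.
have t1 : - a / (b - a) <= 1 by rewrite ler_pdivrMr//; lra.
have := H _ t0 t1; rewrite leNgt => /negP; apply.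
have -> : a + - a / (b - a) * b = - (a * a / (b - a)) by field; rewrite gt_eqF.
by rewrite oppr_lt0 divr_gt0// nmulr_rgt0.
Qed.

Section PIRE.
Context {R : realType} {n d : nat}.
Variables (lambda : R) (f : 'rV[R]_d -> R) (g : 'rV[R]_n -> 'rV[R]_d)
  (h : 'rV[R]_n -> R).

(* C2 applied to the weight [c *: w] and to the centre [z]: dividing by [c] and
   letting [c] tend to infinity removes the quadratic term. *)
Lemma condC2_convex (w : 'rV[R]_d) (y z : 'rV[R]_n) (t : R) :
  condC2 lambda g -> orthant w -> 0 < t -> t <= 1 ->
  lambda * dot w (g (z + t *: (y - z))) <=
    t * (lambda * dot w (g y)) + (1 - t) * (lambda * dot w (g z)).
Proof.
move=> [_ cvx] w0 t0 t1; rewrite leNgt; apply/negP => gap.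
set A := lambda * dot w (g (z + t *: (y - z))) in gap.
set B := t * _ + _ in gap; pose N := dot (y - z) (y - z).
have N0 : 0 <= N := dot_ge0 _.
have AB : 0 < A - B by rewrite subr_gt0.
(* This [c] scales the supposed gap to [N + 1], whereas the quadratic terms can only absorb
   [t * (1 - t) * N / 2]. *)
pose c := (N + 1) / (A - B).
have c0 : 0 <= c by rewrite divr_ge0 ?ltW//; lra.
have cw0 : orthant (c *: w) by move=> i; rewrite mxE mulr_ge0.
have cAB : c * (A - B) = N + 1 by rewrite divfK// gt_eqF.
pose s := Itv01 (ltW t0) t1.
have convE : conv s (y : convex_lmodType 'rV[R]_n) z = z + t *: (y - z).
  rewrite [LHS](_ : _ = t *: y + (1 - t) *: z)// scalerBl scale1r scalerBr.
  by rewrite addrCA.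
have := cvx _ z cw0 s y z (in_setT _) (in_setT _).
rewrite convE convRE/= [z + _ - z]addrAC !subrr add0r !sqr_norm2 !dotZl dotZr.
rewrite dot0l -/N.
rewrite /unstable.onem !(mulrCA lambda) -/A => cvxN.
have tN : 0 <= t * (1 - t) * N by rewrite !mulr_ge0// ?subr_ge0// ltW.
have tN2 : 0 <= (1 - t * (1 - t)) * N.
  by rewrite mulr_ge0//; have := sqr_ge0 t; nra.
rewrite /B in cAB; nra.
Qed.

(** Comparing [z] with [z + t *: (y - z)] and dividing by [t] leaves an error
    [t * (mu / 2) * norm2 (y - z) ^+ 2], which vanishes as [t] tends to 0. Comparing with [y]
    directly would keep it at [t = 1] and lead only to the condition [L < mu]. *)
Lemma prox_step_decrease (mu : R) (w : 'rV[R]_d) (b y z : 'rV[R]_n) :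
  condC2 lambda g -> orthant w -> 0 <= mu ->
  is_argmin (fun v => lambda * dot w (g v) + mu / 2 * norm2 (v - b) ^+ 2) z ->
  lambda * dot w (g z) <= lambda * dot w (g y) + mu * dot (z - b) (y - z).
Proof.
move=> C2 w0 mu0 zmin; rewrite -subr_ge0.
apply: (@ge0_of_affine_perturbation _ _ (mu / 2 * norm2 (y - z) ^+ 2)).
  by rewrite mulr_ge0 ?sqr_ge0// divr_ge0.
move=> t t0 t1.
have := zmin (z + t *: (y - z)); have := condC2_convex w y z t C2 w0 t0 t1.
rewrite /= [z + _ - b]addrAC (sqr_norm2D (z - b)) dotZr norm2Z exprMn.
rewrite gtr0_norm// => cvx zle.
rewrite -(pmulr_rge0 _ t0); nra.
Qed.

(** Testing the supergradient inequality at [y0 + delta_mx 0 i] bounds the increase of [f] by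
    [w 0 i], and monotonicity makes that increase nonnegative. C2 thus applies to every weight. *)
Lemma orthant_weight (y0 w : 'rV[R]_d) : condC1 f -> orthant y0 ->
  subdifferential orthant (fun y => - f y) y0 (- w) -> orthant w.
Proof.
move=> [_ _ fincr] y00 wsub i.
have y0i : orthant (y0 + delta_mx 0 i).
  by move=> j; rewrite !mxE addr_ge0//; case: eqP.
have := wsub _ y0i; rewrite addrAC subrr add0r.
have := fincr y0 i 1 y00 ler01; rewrite scale1r.
have -> : dot (- w) (delta_mx 0 i) = - w 0 i.
  rewrite dotNl /dot (bigD1 i)//= mxE !eqxx mulr1 big1 ?addr0// => j ji.
  by rewrite mxE (negPf ji) mulr0.
lra.
Qed.

(** * Decrease, boundedness and summability along the iterates *)

Section Sequence.
Set Implicit Arguments.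
Unset Strict Implicit.
Variables (L mu : R) (x : nat -> 'rV[R]_n) (w : nat -> 'rV[R]_d).
Hypotheses (lambda_gt0 : 0 < lambda) (C1 : condC1 f) (C2 : condC2 lambda g)
  (L_gt0 : 0 < L) (C3 : condC3 h L) (C4 : condC4 lambda f g h)
  (mu_gt : L / 2 < mu) (xw : PIRE lambda f g h mu x w).
Let F := objective lambda f g h.

Let mu_gt0 : 0 < mu. Proof. by apply: lt_trans mu_gt; rewrite divr_gt0. Qed.

Lemma PIRE_weight_orthant k : orthant (w k).
Proof.
case: xw => w0 _ wsub; case: k => // k.
by apply: orthant_weight (wsub k); last exact: C2.1.
Qed.

Lemma PIRE_decrease k : (1 <= k)%N ->
  (mu - L / 2) * norm2 (x k - x k.+1) ^+ 2 <= F (x k) - F (x k.+1).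
Proof.
(* The index starts at 1 because [w 0] is an arbitrary nonnegative weight, not a supergradient at
   [g (x 0)]. *)
case: k => // k _; case: xw => _ xmin wsub.
have fle : f (g (x k.+2)) <=
    f (g (x k.+1)) + (dot (w k.+1) (g (x k.+2)) - dot (w k.+1) (g (x k.+1))).
  by have := wsub k (g (x k.+2)) (C2.1 _); rewrite !dotE; lra.
have := prox_step_decrease _ _ _ (x k.+1) _ C2 (PIRE_weight_orthant _)
  (ltW mu_gt0) (xmin k.+1).
have := descent_lemma h L (x k.+1) (x k.+2) C3.
rewrite -(norm2N (x k.+2 - x k.+1)) opprB /F /objective.
move: fle; rewrite -(ler_pM2l lambda_gt0) => fle.
set G := gradient _ _; set v := x k.+1 - x k.+2.
have -> : x k.+2 - x k.+1 = - v by rewrite opprB.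
have -> : x k.+2 - (x k.+1 - mu^-1 *: G) = - v + mu^-1 *: G.
  by rewrite !opprB addrA addrAC.
have -> : mu * dot (- v + mu^-1 *: G) v = dot G v - mu * norm2 v ^+ 2.
  by rewrite dotDl dotNl dotZl sqr_norm2; field; rewrite gt_eqF.
rewrite dotNr; lra.
Qed.

Lemma PIRE_nonincreasing k : (1 <= k)%N -> F (x k.+1) <= F (x k).
Proof.
move=> k1; rewrite -subr_ge0; apply: le_trans (PIRE_decrease k1).
by rewrite mulr_ge0 ?sqr_ge0// subr_ge0 ltW.
Qed.

Lemma PIRE_le_first k : F (x k.+1) <= F (x 1%N).
Proof. by elim: k => // k; apply: le_trans; exact: PIRE_nonincreasing. Qed.

Lemma PIRE_bounded : exists M : R, forall k, norm2 (x k) <= M.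
Proof.
apply: contrapT => /forallNP xunb.
(* [s] need not be increasing, since C4 concerns arbitrary sequences. *)
have /choice[s sgt] (j : nat) : exists k, j%:R < norm2 (x k).
  by have /existsNP[k /negP] := xunb j%:R; rewrite -ltNge; exists k.
have := (C4 (x \o s)).2 _; rewrite -/F => Foo.
have /Foo : norm2 ((x \o s) j) @[j --> \oo] --> +oo.
  apply/cvgryPge => A; near=> j; apply/ltW/(le_lt_trans _ (sgt j)).
  by near: j; exact: nbhs_infty_ger.
(* The decrease does not control [F (x 0)], hence the maximum. *)
move=> /cvgryPgt/(_ (Num.max (F (x 0%N)) (F (x 1%N))))[N _ /(_ N (leqnn N))] /=.
rewrite ltNge le_max; case: (s N) => [|k]; first by rewrite lexx.
by rewrite PIRE_le_first orbT.
Unshelve. all: by end_near. Qed.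

Lemma PIRE_bounded_below : exists m : R, forall k, m <= F (x k).
Proof.
have [M xM] := PIRE_bounded; have [f0 _ _] := C1; have [_ _ hL] := C3.
pose G := norm2 (gradient h 0).
(* The descent lemma from [x k] to 0 gives the first term subtracted; splitting the gradient at
   [x k] around its value at 0 gives the other two. *)
exists (h 0 - (L / 2 * M ^+ 2 + L * M ^+ 2 + G * M)) => k.
have := descent_lemma h L (x k) 0 C3; rewrite sub0r norm2N dotNr.
have := cauchy_schwarz (gradient h 0 - gradient h (x k)) (x k).
have := hL 0 (x k); rewrite sub0r norm2N => /(ler_wpM2r (norm2_ge0 (x k))).
have := cauchy_schwarz (- gradient h 0) (x k); rewrite norm2N.
have Mx : norm2 (x k) ^+ 2 <= M ^+ 2.
  by rewrite lerXn2r ?nnegrE ?norm2_ge0 ?(le_trans _ (xM k))// norm2_ge0.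
have LM : L * norm2 (x k) ^+ 2 <= L * M ^+ 2 by rewrite ler_pM2l.
have GM : G * norm2 (x k) <= G * M by rewrite ler_wpM2l// norm2_ge0.
have lf : 0 <= lambda * f (g (x k)).
  by rewrite mulr_ge0 ?(ltW lambda_gt0)// f0//; exact: C2.1.
rewrite dotDl !dotNl /F /objective -/G; nra.
Qed.

(** The lower bound [m] is kept free: [m = 0] gives the constant with [D], and the bound along the
    iterates gives finiteness in general. *)
Lemma PIRE_partial_sum (m : R) N : (forall k, m <= F (x k)) ->
  \sum_(1 <= k < N) norm2 (x k - x k.+1) ^+ 2 <=
    2 * (F (x 1%N) - m) / (2 * mu - L).
Proof.
move=> mF.
have muL : 0 < 2 * mu - L by move: mu_gt; lra.
rewrite ler_pdivlMr//.
have [N1|N1] := leqP N 1.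
  by rewrite big_geq// mul0r mulr_ge0// subr_ge0.
have tele : (\sum_(1 <= k < N) norm2 (x k - x k.+1) ^+ 2) * (mu - L / 2) <=
    F (x 1%N) - F (x N).
  rewrite mulr_suml -(opprB (F (x N))).
  rewrite -(telescope_sumr (fun k => F (x k))) 1?ltnW//.
  rewrite -sumrN big_nat [leRHS]big_nat; apply: ler_sum => k /andP[k1 _].
  by rewrite mulrC opprB PIRE_decrease.
have := mF N; lra.
Qed.

Lemma PIRE_series_le (m : R) : (forall k, m <= F (x k)) ->
  (\sum_(1 <= k <oo) (norm2 (x k - x k.+1) ^+ 2)%:E <=
    (2 * (F (x 1%N) - m) / (2 * mu - L))%:E)%E.
Proof.
move=> mF; apply: lime_le.
  by apply: is_cvg_nneseries => k _ _; rewrite lee_fin sqr_ge0.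
by apply: nearW => N; rewrite sumEFin lee_fin PIRE_partial_sum.
Qed.

Lemma PIRE_step_cvg0 : (x k - x k.+1) @[k --> \oo] --> (0 : 'rV[R]_n).
Proof.
have [m mF] := PIRE_bounded_below.
(* The shift by one skips the step from [x 0], which the partial sums leave out. *)
pose u k := norm2 (x k.+1 - x k.+2) ^+ 2.
have u0 : u k @[k --> \oo] --> 0.
  apply: cvg_series_cvg_0; apply: nondecreasing_is_cvgn.
    by apply: nondecreasing_series => k _ _; exact: sqr_ge0.
  exists (2 * (F (x 1%N) - m) / (2 * mu - L)) => _ [N _ <-].
  rewrite seriesEnat /=; apply: le_trans (PIRE_partial_sum N.+1 mF).
  by rewrite big_add1.
rewrite -(cvg_shiftS (fun k => x k - x k.+1)).
apply/cvgr0Pnorm_lt => e e0.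
have e20 : 0 < e ^+ 2 by rewrite exprn_gt0.
have /cvgr0Pnorm_lt/(_ _ e20) := u0; apply: filterS => k.
rewrite ger0_norm ?sqr_ge0// => ue; apply: le_lt_trans (ler_mx_norm_norm2 _) _.
by rewrite -(ltr_pXn2r (n := 2))// ?nnegrE ?norm2_ge0// ltW.
Qed.
End Sequence.
End PIRE.

(** The bound by [D] is tied to [F] being nonnegative: subtracting a constant from [h] preserves C1
    to C4 and the iterates but can make [D] negative. Finiteness of the sum and vanishing steps hold
    regardless. *)
Theorem theorem1 (R : realType) (n d : nat) (lambda L mu : R)
    (f : 'rV[R]_d -> R) (g : 'rV[R]_n -> 'rV[R]_d) (h : 'rV[R]_n -> R)
    (x : nat -> 'rV[R]_n) (w : nat -> 'rV[R]_d)
    (lambda_gt0 : 0 < lambda) (C1 : condC1 f) (C2 : condC2 lambda g)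
    (L_gt0 : 0 < L) (C3 : condC3 h L) (C4 : condC4 lambda f g h)
    (mu_gt : L / 2 < mu) (xw : PIRE lambda f g h mu x w) :
  let F := objective lambda f g h in
  let D := F (x 1%N) in
  [/\ (forall k, (1 <= k)%N -> F (x k.+1) <= F (x k)) /\
      (forall k, (1 <= k)%N ->
         (mu - L / 2) * norm2 (x k - x k.+1) ^+ 2 <= F (x k) - F (x k.+1)),
      (exists M : R, forall k, norm2 (x k) <= M),
      (\sum_(1 <= k <oo) (norm2 (x k - x k.+1) ^+ 2)%:E < +oo)%E /\
      ((forall z, 0 <= F z) ->
       (\sum_(1 <= k <oo) (norm2 (x k - x k.+1) ^+ 2)%:E
         <= (2 * D / (2 * mu - L))%:E)%E) &
      (x k - x k.+1) @[k --> \oo] --> (0 : 'rV[R]_n)].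
Proof.
move=> F D; split.
- split=> k k1.
  + exact: (PIRE_nonincreasing lambda_gt0 C1 C2 L_gt0 C3 mu_gt xw).
  + exact: (PIRE_decrease lambda_gt0 C1 C2 L_gt0 C3 mu_gt xw).
- exact: (PIRE_bounded lambda_gt0 C1 C2 L_gt0 C3 C4 mu_gt xw).
- have series_le := PIRE_series_le lambda_gt0 C1 C2 L_gt0 C3 mu_gt xw.
  split=> [|F0]; last first.
    by rewrite /D -[F (x 1%N)]subr0; apply: series_le => k; exact: F0.
  have [m mF] := PIRE_bounded_below lambda_gt0 C1 C2 L_gt0 C3 C4 mu_gt xw.
  exact: le_lt_trans (series_le m mF) (ltry _).
- exact: (PIRE_step_cvg0 lambda_gt0 C1 C2 L_gt0 C3 C4 mu_gt xw).
Qed.
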